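(* Let $n,N,s\ge 1$ be integers, let $(X_1,Y_1),\dots,(X_N,Y_N)\in\mathbb{R}^n\times\mathbb{R}$ be given data, let $X:=(X_1,\dots,X_N)^T\in\mathbb{R}^{N\times n}$ and $Y:=(Y_1,\dots,Y_N)^T\in\mathbb{R}^N$, and let $\mathbb{P}_N:=\frac1N\sum_{i=1}^N \mathbf{1}_{\{(X_i,Y_i)\}}$ be the empirical distribution on $\mathbb{R}^{n+1}$. Let $P:\mathbb{R}^n\to\mathbb{R}$ and $Q:\mathbb{R}^s\to\mathbb{R}$ be norms, let $B\in\mathbb{R}^{s\times n}$, let $w_1,w_2\ge 0$ with $w_1+w_2=1$, and let $$p(\beta):=w_1P(\beta)+w_2Q(B\beta),\qquad \beta\in\mathbb{R}^n.$$ Let $p_*(\alpha):=\sup_{\beta\in\mathbb{R}^n}\{\langle\alpha,\beta\rangle \mid p(\beta)\le 1\}\in[0,+\infty]$ for $\alpha\in\mathbb{R}^n$. Consider the squared-loss function $\ell(x,y;\beta):=(y-\beta^Tx)^2$ for $x\in\mathbb{R}^n$, $y\in\mathbb{R}$, $\beta\in\mathbb{R}^n$, and let the cost function $c:\mathbb{R}^{n+1}\times\mathbb{R}^{n+1}\to[0,+\infty]$ be $$c((u,v),(x,y)):=\begin{cases}(p_*(u-x))^2, & \text{if } v=y,\\ +\infty, & \text{otherwise,}\end{cases}\qquad u,x\in\mathbb{R}^n,\ v,y\in\mathbb{R},$$ with associated optimal transport cost $\mathcal{D}_c(\cdot,\cdot)$. Then for every $\delta\ge 0$, $$\inf_{\beta\in\mathbb{R}^n}\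 \sup_{\mathbb{P}:\,\mathcal{D}_c(\mathbb{P},\mathbb{P}_N)\le\delta} \mathrm{E}_{\mathbb{P}}[\ell(\mathsf{X},\mathsf{Y};\beta)] \;=\; \frac1N\,\inf_{\beta\in\mathbb{R}^n}\Big(\|Y-X\beta\|+\sqrt{\delta N}\,p(\beta)\Big)^2,$$ where on the left-hand side $\mathbb{P}$ ranges over probability measures on $\mathbb{R}^{n+1}=\mathbb{R}^n\times\mathbb{R}$ and $(\mathsf{X},\mathsf{Y})$ denotes a random vector with distribution $\mathbb{P}$.
   Context: $\|\cdot\|$ is the Euclidean norm and $\langle x,y\rangle=x^Ty$. $\mathbf{1}_{\{z\}}$ denotes the Dirac measure at $z$. For (Borel) probability measures $\mathbb{P},\mathbb{Q}$ on $\mathbb{R}^{n+1}$, $\Pi(\mathbb{P},\mathbb{Q})$ is the set of all joint probability measures on $\mathbb{R}^{n+1}\times\mathbb{R}^{n+1}$ whose first and second marginals are $\mathbb{P}$ and $\mathbb{Q}$, and the optimal transport cost is $$\mathcal{D}_c(\mathbb{P},\mathbb{Q}):=\inf_{\pi\in\Pi(\mathbb{P},\mathbb{Q})}\int c(u,v)\,d\pi(u,v).$$ The function $p$ may be only a seminorm (when $w_1=0$), in which case $p_*$ may take the value $+\infty$, and $(+\infty)^2=+\infty$. *)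

(* Defs.v *)
From HB Require Import structures.
From mathcomp Require Import all_boot all_order all_algebra.
From mathcomp Require Import all_classical all_reals all_analysis.

Set Implicit Arguments.
Unset Strict Implicit.
Unset Printing Implicit Defensive.

Import Order.TTheory GRing.Theory Num.Theory.
Import numFieldNormedType.Exports.

Local Open Scope classical_set_scope.
Local Open Scope ring_scope.

Section Euclidean.
Context {R : realType}.

Definition dot {n} (x y : 'cV[R]_n) : R := (x^T *m y) 0 0.

(* The library norm `|x| on matrices is the sup norm, hence this definition. *)
Definition enorm {n} (x : 'cV[R]_n) : R := Num.sqrt (dot x x).

Record is_norm {n} (f : 'cV[R]_n -> R) : Prop := IsNorm {
  is_norm_ge0 : forall x, 0 <= f x ;
  is_norm_eq0 : forall x, f x = 0 -> x = 0 ;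
  is_normZ : forall (a : R) x, f (a *: x) = `|a| * f x ;
  is_normD : forall x y, f (x + y) <= f x + f y
}.

Definition mixed_seminorm {n s} (w1 w2 : R) (P : 'cV[R]_n -> R)
    (Q : 'cV[R]_s -> R) (B : 'M[R]_(s, n)) (b : 'cV[R]_n) : R :=
  w1 * P b + w2 * Q (B *m b).

Definition dual_norm {n} (p : 'cV[R]_n -> R) (a : 'cV[R]_n) : \bar R :=
  ereal_sup [set (dot a b)%:E | b in [set b | p b <= 1]].

End Euclidean.

(* R^n x R with the Borel sigma-algebra of its usual topology: the library has
   a topology on 'cV[R]_n but no measurable structure. *)
Notation data_space R n :=
  (g_sigma_algebraType (@open ('cV[R]_n * R)%type)).

Section OptimalTransport.
Local Open Scope ereal_scope.
Context {d} {T : measurableType d} {R : realType}.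

Definition couplings (mu nu : {measure set T -> \bar R}) :
    set (probability (T * T)%type R) :=
  [set pi | forall A : set T, measurable A ->
     pushforward pi fst A = mu A /\ pushforward pi snd A = nu A].

Definition transport_cost (c : T -> T -> \bar R)
    (mu nu : {measure set T -> \bar R}) : \bar R :=
  ereal_inf [set \int[pi]_z c z.1 z.2 | pi in couplings mu nu].

Section Empirical.
Context {N : nat} (z : 'I_N -> T).

Definition dirac_sum (A : set T) : \bar R := \sum_(i < N) \d_(z i) A.

Let dirac_sum0 : dirac_sum set0 = 0.
Proof. by rewrite /dirac_sum big1. Qed.

Let dirac_sum_ge0 A : 0 <= dirac_sum A.
Proof. by rewrite /dirac_sum; apply: sume_ge0. Qed.

Let dirac_sum_sigma_additive : semi_sigma_additive dirac_sum.
Proof.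
move=> F mF tF mUF; rewrite [X in _ --> X](_ : _ =
    lim ((fun n => \sum_(0 <= i < n) dirac_sum (F i)) @ \oo)).
  by apply: is_cvg_ereal_nneg_natsum => k _; exact: sume_ge0.
rewrite nneseries_sum//; apply: eq_bigr => /= i _.
exact: measure_semi_bigcup.
Qed.

HB.instance Definition _ := isMeasure.Build _ _ _ dirac_sum
  dirac_sum0 dirac_sum_ge0 dirac_sum_sigma_additive.

Definition empirical : {measure set T -> \bar R} :=
  mscale ((N%:R^-1)%:nng)%R dirac_sum.

Lemma empiricalE A : empirical A = (N%:R^-1)%:E * \sum_(i < N) \d_(z i) A.
Proof. by []. Qed.

Lemma empirical_setT : (0 < N)%N -> empirical setT = 1.
Proof.
move=> N0; rewrite empiricalE; under eq_bigr do rewrite diracT.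
rewrite sumEFin -EFinM sumr_const card_ord mulVf//.
by rewrite pnatr_eq0 -lt0n.
Qed.

End Empirical.

End OptimalTransport.

Section Regression.
Context {R : realType} {n : nat}.

Definition sq_loss (b : 'cV[R]_n) (z : data_space R n) : R :=
  (z.2 - dot b z.1) ^+ 2.

Definition label_cost (p : 'cV[R]_n -> R) (z z' : data_space R n) : \bar R :=
  if z.2 == z'.2 then (dual_norm p (z.1 - z'.1)%R ^+ 2)%E else +oo%E.

End Regression.

(* Main.v *)
Require Import Defs.
From HB Require Import structures.
From mathcomp Require Import all_boot all_order all_algebra.
From mathcomp Require Import all_classical all_reals all_analysis.
From mathcomp Require Import measurable_realfun ring lra.

Import Order.TTheory GRing.Theory Num.Theory.
Import numFieldNormedType.Exports.

Local Open Scope classical_set_scope.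
Local Open Scope ring_scope.

(** The two sides agree already before the infimum over [b]: for each fixed
    [b] the worst-case risk is [(sqrt r + sqrt delta * p b) ^+ 2], where [r] is
    the mean squared residual of the data ([worst_case_risk]), and [r] is
    [enorm (Y - X *m b) ^+ 2 / N].

    Upper bound.  Moving a data point from [w'] to [w] changes its residual
    [w.2 - dot b w.1] by at most [p b] times the dual norm of the displacement,
    so the squared change is at most [p b ^+ 2] times the transport cost
    ([residual_shift_le_cost]; a change of label costs [+oo]).  Under any
    coupling of [mu] with the empirical measure, the residual for [mu] is the
    empirical residual plus a change whose second moment is thus controlled, and
    the triangle inequality in L2 gives the bound.  It is used in the form
    [(u + v)^2 <= (1 + t) u^2 + (1 + 1/t) v^2], integrated and optimised over
    [t] ([coupling_risk_le], [le_sqr_sum_of_young]).  The infimum defining the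
    transport cost need not be attained and [p b] may vanish, so the bound is
    proved for all [K > p b] and [kappa > delta] before passing to the limit.

    Lower bound.  By the Hahn-Banach theorem some [a] satisfies
    [dot a x <= p x] for all [x] and [dot a b = p b] ([seminorm_norming]).
    Shifting the i-th point by [theta i *: a] costs at most [theta i ^+ 2] and
    moves its residual by exactly [- theta i * p b]; choosing [theta]
    proportional to the residuals, with mean square [delta], makes every
    residual grow by the same factor and attains the bound
    ([shifted_empirical], [worst_case_attained]).  When all residuals vanish a
    constant [theta] does.

    The transport cost is the integral of a supremum of uncountably many
    functions.  It is bounded from both sides by two facts valid for every
    nonnegative function, whose integral is the supremum of the integrals of the
    simple functions below it: monotonicity ([ge0_integral_mono]) and, for an
    empirical measure, the bound by the average over the atoms
    ([integral_empirical_le]). *)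

Set Implicit Arguments.
Unset Strict Implicit.

(** * Dominated linear forms on column vectors *)

Record sublinear {R : realType} {V : lmodType R} (q : V -> R) :
  Prop := Sublinear {
  sublinearZ : forall a x, 0 < a -> q (a *: x) = a * q x ;
  sublinearD : forall x y, q (x + y) <= q x + q y
}.

Lemma sublinear0 {R : realType} {V : lmodType R} (q : V -> R) :
  sublinear q -> q 0 = 0.
Proof.
move=> sq; have := sublinearZ sq (0 : V) (ltr0n R 2).
by rewrite scaler0 => ?; lra.
Qed.

Lemma sublinear_oppr_ge {R : realType} {V : lmodType R} (q : V -> R) (x : V) :
  sublinear q -> - q (- x) <= q x.
Proof.
move=> sq; have := sublinearD sq x (- x).
by rewrite subrr (sublinear0 sq) => ?; lra.
Qed.

(** The minorant is [x |-> inf_(t >= 0) (q (x + t v) - t q v)]: taking [t = 0]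
    gives domination by [q], and [t = 1] at [- v] gives the last inequality,
    which forces the minorant to be additive along the line of [v]. *)
Lemma sublinear_minorant {R : realType} {V : lmodType R} (q : V -> R) (v : V) :
  sublinear q ->
  exists q', [/\ sublinear q', forall x, q' x <= q x & q' (- v) <= - q v].
Proof.
move=> sq.
pose S x := [set q (x + t *: v) - t * q v | t in [set t : R | 0 <= t]].
have S_lb x : lbound (S x) (- q (- x)).
  move=> _ [t /= t0 <-].
  have qtv : q (t *: v) = t * q v.
    move: t0; rewrite le_eqVlt => /orP[/eqP <-|t0]; last exact: sublinearZ.
    by rewrite scale0r mul0r; exact: sublinear0.
  have := sublinearD sq (x + t *: v) (- x).
  by rewrite addrAC subrr add0r qtv => ?; lra.
have S_inf x t : 0 <= t -> inf (S x) <= q (x + t *: v) - t * q v.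
  by move=> t0; apply: ge_inf; [exists (- q (- x)) | exists t].
have le_infS x c :
    (forall t, 0 <= t -> c <= q (x + t *: v) - t * q v) -> c <= inf (S x).
  move=> h; apply: lb_le_inf.
    by exists (q (x + 0 *: v) - 0 * q v), 0 => /=.
  by move=> _ [t /= t0 <-]; exact: h.
have infZ_le a x : 0 < a -> a * inf (S x) <= inf (S (a *: x)).
  move=> a0; apply: le_infS => t t0.
  have := S_inf x (a^-1 * t) (mulr_ge0 (ltW (eqbRL (invr_gt0 a) a0)) t0).
  have -> : a *: x + t *: v = a *: (x + (a^-1 * t) *: v).
    by rewrite scalerDr scalerA mulrA divff ?mul1r ?gt_eqF.
  rewrite (sublinearZ sq)// -(ler_pM2l a0) => /le_trans; apply.
  by rewrite mulrBr !mulrA divff ?mul1r// gt_eqF.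
exists (fun x => inf (S x)); split.
- split=> [a x a0|x y].
    apply/eqP; rewrite eq_le infZ_le// andbT.
    have := infZ_le a^-1 (a *: x).
    rewrite scalerA mulVf ?gt_eqF// scale1r invr_gt0 => /(_ a0).
    by rewrite ler_pdivrMl.
  have addS s t : 0 <= s -> 0 <= t -> inf (S (x + y)) <=
      (q (x + s *: v) - s * q v) + (q (y + t *: v) - t * q v).
    move=> s0 t0; apply: (le_trans (S_inf _ (s + t) (addr_ge0 s0 t0))).
    have := sublinearD sq (x + s *: v) (y + t *: v).
    by rewrite addrACA -scalerDl => ?; lra.
  rewrite -lerBlDr; apply: (le_infS _ _) => s s0.
  rewrite lerBlDr -lerBlDl; apply: le_infS => t t0.
  by have := addS s t s0 t0; lra.
- by move=> x; have := S_inf x 0 (lexx _); rewrite scale0r addr0 mul0r subr0.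
- have := S_inf (- v) 1 ler01.
  by rewrite scale1r addNr (sublinear0 sq) mul1r sub0r.
Qed.

(** Oddness at a vector survives passing to a smaller sublinear function, so it
    can be acquired one vector at a time.  For [vs] spanning [V] this is the
    finite-dimensional replacement for Zorn's lemma. *)
Lemma sublinear_odd_minorant {R : realType} {V : lmodType R} (q : V -> R)
    (vs : seq V) : sublinear q ->
  exists q', [/\ sublinear q', forall x, q' x <= q x &
    {in vs, forall v, q' (- v) = - q' v}].
Proof.
elim: vs q => [|v vs IH] q sq; first by exists q.
have [q1 [sq1 q1q q1v]] := sublinear_minorant v sq.
have [q2 [sq2 q2q1 q2vs]] := IH _ sq1.
exists q2; split=> // [x|w]; first exact: le_trans (q2q1 x) (q1q x).
rewrite inE => /predU1P[->|]; last exact: q2vs.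
have := sublinear_oppr_ge v sq2; have := q2q1 (- v).
by have := q2q1 v; have := q1q v; lra.
Qed.

Section DotProduct.
Context {R : realType} {n : nat}.
Implicit Types a b x : 'cV[R]_n.

Lemma dotE a b : dot a b = \sum_i a i 0 * b i 0.
Proof. by rewrite /dot mxE; apply: eq_bigr => i _; rewrite mxE. Qed.

Lemma dotC a b : dot a b = dot b a.
Proof. by rewrite !dotE; apply: eq_bigr => i _; rewrite mulrC. Qed.

Lemma dotDr a b x : dot a (b + x) = dot a b + dot a x.
Proof. by rewrite /dot mulmxDr mxE. Qed.

Lemma dotZr a (k : R) b : dot a (k *: b) = k * dot a b.
Proof. by rewrite /dot -scalemxAr mxE. Qed.

Lemma dotNr a b : dot a (- b) = - dot a b.
Proof. by rewrite -scaleN1r dotZr mulN1r. Qed.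

Lemma dotBr a b x : dot a (b - x) = dot a b - dot a x.
Proof. by rewrite dotDr dotNr. Qed.

(** A first minorant secures the value at [b], a second one oddness at the
    standard basis; the second is then a linear form, with coordinates [a]. *)
Lemma hahn_banach (q : 'cV[R]_n -> R) b : sublinear q ->
  exists a, (forall x, dot a x <= q x) /\ dot a b = q b.
Proof.
move=> sq.
have [q1 [sq1 q1q q1b]] := sublinear_minorant b sq.
pose e i : 'cV[R]_n := delta_mx i 0.
have [q2 [sq2 q2q1 q2e]] := sublinear_odd_minorant [seq e i | i : 'I_n] sq1.
pose a : 'cV[R]_n := \col_i q2 (e i).
have q2_le x : q2 x <= dot a x.
  have xE : x = \sum_i x i 0 *: e i.
    rewrite [LHS]matrix_sum_delta; apply: eq_bigr => i _.
    by rewrite big_ord1.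
  have -> : dot a x = \sum_i x i 0 * q2 (e i).
    by rewrite dotE; apply: eq_bigr => i _; rewrite mxE mulrC.
  rewrite [in X in X <= _]xE.
  elim/big_rec2: _ => [|i u v _ uv]; first by rewrite (sublinear0 sq2).
  apply: (le_trans (sublinearD sq2 _ _)); apply: lerD => //.
  have [xi0|xi0|->] := ltgtP (x i 0) 0.
  - rewrite -[x i 0]opprK scaleNr -scalerN (sublinearZ sq2) ?oppr_gt0//.
    by rewrite q2e ?fintype.image_f// mulrNN opprK.
  - by rewrite (sublinearZ sq2).
  - by rewrite scale0r mul0r (sublinear0 sq2).
have q2E x : dot a x = q2 x.
  have := q2_le x; have := q2_le (- x); rewrite dotNr.
  by have := sublinear_oppr_ge x sq2; lra.
exists a; split=> [x|]; first by rewrite q2E; exact: le_trans (q2q1 x) (q1q x).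
apply/eqP; rewrite eq_le {1}q2E (le_trans (q2q1 _) (q1q _))//=.
by have := q2q1 (- b); rewrite -q2E dotNr; lra.
Qed.

End DotProduct.

(** * Seminorms, their dual norms and the transport cost *)

Record is_seminorm {R : realType} {n} (p : 'cV[R]_n -> R) : Prop := IsSeminorm {
  seminorm_ge0 : forall x, 0 <= p x ;
  seminormZ : forall (a : R) x, p (a *: x) = `|a| * p x ;
  seminormD : forall x y, p (x + y) <= p x + p y
}.

Definition residual {R : realType} {n} (b : 'cV[R]_n) (w : data_space R n) :
  R := w.2 - dot b w.1.

Section DualNorm.
Context {R : realType} {n : nat}.
Variable p : 'cV[R]_n -> R.
Hypothesis sp : is_seminorm p.
Implicit Types a b : 'cV[R]_n.

Lemma seminorm_sublinear : sublinear p.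
Proof.
split; last exact: seminormD.
by move=> a x a0; rewrite (seminormZ sp) gtr0_norm.
Qed.

Lemma seminormN b : p (- b) = p b.
Proof. by rewrite -scaleN1r (seminormZ sp) normrN1 mul1r. Qed.

Lemma seminorm0 : p 0 = 0.
Proof. exact: sublinear0 seminorm_sublinear. Qed.

Lemma seminorm_norming b :
  exists a, (forall x, dot a x <= p x) /\ dot a b = p b.
Proof. exact: hahn_banach seminorm_sublinear. Qed.

Lemma dual_norm_ge0 a : (0 <= dual_norm p a)%E.
Proof.
apply: ereal_sup_ubound; exists 0; rewrite /= ?seminorm0 ?ler01//.
by rewrite dotE big1// => i _; rewrite mxE mulr0.
Qed.

(** The hypothesis says that [a] has dual norm at most 1. *)
Lemma dual_normZ_le a (k : R) : (forall x, dot a x <= p x) ->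
  (dual_norm p (k *: a) <= `|k|%:E)%E.
Proof.
move=> ap; apply: ge_ereal_sup => _ [x /= px1 <-]; rewrite lee_fin.
rewrite dotC dotZr dotC; apply: (le_trans (ler_norm _)); rewrite normrM.
rewrite ler_piMr//; apply: le_trans px1; rewrite ler_norml lerNl -dotNr.
by rewrite -[p x]seminormN ap seminormN ap.
Qed.

(** Dividing by some [K > p b] instead of [p b] covers the case [p b = 0]: if
    then [dot a b != 0], the quotient is unbounded as [K] decreases to 0, in
    accordance with an infinite dual norm. *)
Lemma dot_le_dual_norm a b K : p b < K ->
  ((`|dot a b| / K)%:E <= dual_norm p a)%E.
Proof.
move=> pbK; have K0 : 0 < K by apply: le_lt_trans pbK; exact: seminorm_ge0.
suff le_dual c : p c < K -> ((dot a c / K)%:E <= dual_norm p a)%E.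
  have [_|_] := ger0P (dot a b); first exact: le_dual.
  by rewrite -dotNr; apply: le_dual; rewrite seminormN.
move=> pcK; apply: ereal_sup_ubound; exists (K^-1 *: c).
  rewrite /= (seminormZ sp) gtr0_norm ?invr_gt0// mulrC ler_pdivrMr// mul1r.
  exact: ltW.
by rewrite dotZr mulrC.
Qed.

Lemma residual_shift_le_cost b K (z z' : data_space R n) : p b < K ->
  ((((residual b z - residual b z') / K) ^+ 2)%:E
    <= label_cost p z z')%E.
Proof.
move=> pbK; rewrite /label_cost /residual.
case: eqP => [->|_]; last by rewrite leey.
have -> : z'.2 - dot b z.1 - (z'.2 - dot b z'.1) = - dot (z.1 - z'.1) b.
  by rewrite [in RHS]dotC dotBr; ring.
have K0 : 0 < K by apply: le_lt_trans pbK; exact: seminorm_ge0.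
rewrite mulNr sqrrN -real_normK ?num_real// normrM.
rewrite [`|K^-1|]gtr0_norm ?invr_gt0//.
have dK := dot_le_dual_norm (z.1 - z'.1) pbK.
have d0 : 0 <= `|dot (z.1 - z'.1) b| / K by rewrite divr_ge0// ltW.
by rewrite expr2 EFinM expe2; apply: lee_pmul; rewrite ?lee_fin.
Qed.

End DualNorm.

Lemma mixed_seminorm_is_seminorm {R : realType} {n s : nat} (w1 w2 : R)
    (P : 'cV[R]_n -> R) (Q : 'cV[R]_s -> R) (B : 'M[R]_(s, n)) :
  is_norm P -> is_norm Q -> 0 <= w1 -> 0 <= w2 ->
  is_seminorm (mixed_seminorm w1 w2 P Q B).
Proof.
move=> nP nQ w10 w20; rewrite /mixed_seminorm; split.
- by move=> x; rewrite addr_ge0// mulr_ge0//; exact: is_norm_ge0.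
- by move=> a x; rewrite -scalemxAr (is_normZ nP) (is_normZ nQ); ring.
- move=> x y; rewrite mulmxDr addrACA -!mulrDr.
  by apply: lerD; apply: ler_wpM2l => //; exact: is_normD.
Qed.

(** * Integrals of nonnegative functions and empirical measures *)

Section Integrals.
Local Open Scope ereal_scope.
Context {d} {T : measurableType d} {R : realType}.
Implicit Types (mu : {measure set T -> \bar R}) (f : T -> \bar R).

Import HBNNSimple.

Lemma ge0_integral_le_simple mu f u : (forall x, 0 <= f x) ->
  (forall h : {nnsfun T >-> R}, (forall x, (h x)%:E <= f x) ->
    \int[mu]_x (h x)%:E <= u) -> \int[mu]_x f x <= u.
Proof.
move=> f0 hu; rewrite ge0_integralTE//; apply: ge_ereal_sup => _ [h /= hf <-].
by rewrite -integralT_nnsfun; exact: hu.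
Qed.

(** In contrast with [ge0_le_integral], [f] and [g] are arbitrary nonnegative
    functions; this is what allows integrating bounds on the transport cost. *)
Lemma ge0_integral_mono mu f g : (forall x, 0 <= f x) ->
  (forall x, f x <= g x) -> \int[mu]_x f x <= \int[mu]_x g x.
Proof.
move=> f0 fg; rewrite !ge0_integralTE//; last first.
  by move=> x; exact: le_trans (fg x).
apply: le_ereal_sup => _ [h /= hf <-]; exists h => // x.
exact: le_trans (hf x) (fg x).
Qed.

Context {N : nat} (z : 'I_N -> T).

Lemma integral_empirical f :
  (forall x, 0 <= f x) -> measurable_fun [set: T] f ->
  \int[empirical z]_x f x = (N%:R^-1)%:E * \sum_(i < N) f (z i).
Proof.
move=> f0 mf; rewrite ge0_integral_mscale//; congr (_ * _).
case: N z => [|N'] z'.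
  rewrite [RHS]big1 => [|[]//].
  rewrite (eq_measure_integral mzero) ?integral_measure_zero// => A _ _.
  by rewrite /= /dirac_sum big1 => [|[]].
pose m k : {measure set T -> \bar R} := \d_(z' (inord k)).
rewrite (eq_measure_integral (msum m N'.+1)); last first.
  move=> A _ _; rewrite /dirac_sum /msum/=.
  by apply: eq_bigr => i _; rewrite /m inord_val.
rewrite ge0_integral_measure_sum//; apply: eq_bigr => i _.
by rewrite integral_dirac// diracT mul1e inord_val.
Qed.

(** Only an inequality, since for non-measurable [f] the left-hand side is a
    lower integral. *)
Lemma integral_empirical_le f : (forall x, 0 <= f x) ->
  \int[empirical z]_x f x <= (N%:R^-1)%:E * \sum_(i < N) f (z i).
Proof.
move=> f0; apply: ge0_integral_le_simple => // h hf.
have h0 x : 0 <= (h x)%:E by rewrite lee_fin.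
rewrite (integral_empirical h0); last exact/measurable_EFinP.
apply: lee_wpmul2l; first by rewrite lee_fin invr_ge0.
by apply: lee_sum => i _; exact: hf.
Qed.

Lemma empirical_probability : (0 < N)%N ->
  exists P : probability T R, forall A, P A = empirical z A.
Proof.
move=> N0.
pose mP := Measure_isProbability.Build _ _ R (empirical z)
  (empirical_setT z N0).
pose P : probability T R := HB.pack (Measure.sort (empirical z)) mP.
by exists P.
Qed.

End Integrals.

Lemma integral_marginal {d d' : measure_display} {T : measurableType d}
    {T' : measurableType d'} {R : realType}
    (phi : T -> T') (pi : {measure set T -> \bar R})
    (mu : {measure set T' -> \bar R}) (f : T' -> \bar R) :
  measurable_fun [set: T] phi ->
  (forall A, measurable A -> pushforward pi phi A = mu A) ->
  (forall x, 0 <= f x)%E -> measurable_fun [set: T'] f ->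
  (\int[mu]_x f x = \int[pi]_x f (phi x))%E.
Proof.
move=> mphi piE f0 mf.
have -> : (\int[mu]_x f x = \int[pushforward pi phi]_x f x)%E.
  by apply: eq_measure_integral => A mA _; rewrite -piE.
by rewrite ge0_integral_pushforward// preimage_setT.
Qed.

(** * Measurability of the loss *)

Section Loss.
Context {R : realType} {n : nat}.

(** The Borel structure of [data_space] is generated by the open sets, so that
    the preimages of open intervals are among its generators. *)
Lemma continuous_measurable_data_space (f : 'cV[R]_n * R -> R) :
  continuous f ->
  measurable_fun [set: data_space R n] (f : data_space R n -> R).
Proof.
move=> cf; apply: (measurability _ (RGenOpens.measurableE R)).
move=> _ [_ [a [b ->]] <-]; rewrite setTI; apply: sub_sigma_algebra.
by apply: open_comp => //; exact: interval_open.
Qed.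

Lemma measurable_residual (b : 'cV[R]_n) :
  measurable_fun [set: data_space R n] (residual b).
Proof.
rewrite /residual.
under eq_fun do rewrite dotE.
apply: measurable_funB.
  by apply: continuous_measurable_data_space => z; exact: cvg_snd.
apply: measurable_sum => i; apply: measurable_funM; first exact: measurable_cst.
apply: (@continuous_measurable_data_space (fun z => z.1 i 0)) => z.
apply: (@cvg_comp _ _ _ fst (fun x : 'cV[R]_n => x i 0)); first exact: cvg_fst.
exact: coord_continuous.
Qed.

Lemma measurable_sq_loss (b : 'cV[R]_n) :
  measurable_fun [set: data_space R n] (sq_loss b).
Proof. by apply: measurable_funX; exact: measurable_residual. Qed.

End Loss.

(** * Two elementary inequalities *)

Lemma sqr_addr_le {R : realFieldType} (t u v : R) : 0 < t ->
  (u + v) ^+ 2 <= (1 + t) * u ^+ 2 + (1 + t^-1) * v ^+ 2.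
Proof.
move=> t0; rewrite -subr_ge0.
have -> : (1 + t) * u ^+ 2 + (1 + t^-1) * v ^+ 2 - (u + v) ^+ 2
    = t^-1 * (t * u - v) ^+ 2 by field; rewrite gt_eqF.
by rewrite mulr_ge0 ?sqr_ge0// invr_ge0 ltW.
Qed.

(** The weight [t = rho / a] with [rho = sqrt kappa * K] makes the bound the
    square of [a + rho].  As [a] may be 0, it is enlarged by the same [k > 0]
    that separates [K] from [P0] and [sqrt kappa] from [sqrt delta], and then
    [k] tends to 0. *)
Lemma le_sqr_sum_of_young {R : realType} (E : \bar R) (a P0 delta : R) :
  0 <= a -> 0 <= P0 -> 0 <= delta ->
  (forall t K kappa, 0 < t -> P0 < K -> delta < kappa ->
    (E <= ((1 + t) * a ^+ 2 + (1 + t^-1) * (K ^+ 2 * kappa))%:E)%E) ->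
  (E <= ((a + Num.sqrt delta * P0) ^+ 2)%:E)%E.
Proof.
move=> a0 P00 delta0 HE; set s := Num.sqrt delta.
have s0 : 0 <= s by exact: sqrtr_ge0.
have sE : s ^+ 2 = delta by exact: sqr_sqrtr.
have Ek k : 0 < k -> (E <= (((a + k) + (P0 + k) * (s + k)) ^+ 2)%:E)%E.
  move=> k0; set rho := (P0 + k) * (s + k).
  have rho0 : 0 < rho by rewrite mulr_gt0// ltr_wpDl.
  have ak0 : 0 < a + k by rewrite ltr_wpDl.
  have sk : delta < (s + k) ^+ 2 by rewrite -sE; nra.
  apply: (le_trans (HE (rho / (a + k)) (P0 + k) ((s + k) ^+ 2) _ _ sk)).
  - by rewrite divr_gt0.
  - by rewrite ltrDl.
  rewrite lee_fin -exprMn -/rho.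
  have -> : (a + k + rho) ^+ 2 = (1 + rho / (a + k)) * (a + k) ^+ 2
      + (1 + (rho / (a + k))^-1) * rho ^+ 2 by field; rewrite !gt_eqF.
  rewrite lerD2r ler_wpM2l ?addr_ge0 ?divr_ge0 ?(ltW rho0) ?(ltW ak0)//.
  by rewrite lerXn2r ?nnegrE ?(ltW ak0)// lerDl ltW.
apply/lee_addgt0Pr => e e0; set S := a + s * P0.
(* [M] bounds the slope in [k] of the perturbed sum for [k <= 1]. *)
pose M := 2 + s + P0.
have S0 : 0 <= S by rewrite addr_ge0// mulr_ge0.
have M0 : 0 < M by rewrite /M; lra.
have D0 : 0 < 2 * S * M + M ^+ 2.
  by rewrite ltr_wpDl ?exprn_gt0// !mulr_ge0// ltW.
pose k := Num.min 1 (e / (2 * S * M + M ^+ 2)).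
have k0 : 0 < k by rewrite lt_min ltr01 divr_gt0.
have k1 : k <= 1 by rewrite ge_min lexx.
have ke : k * (2 * S * M + M ^+ 2) <= e.
  by rewrite -ler_pdivlMr// ge_min lexx orbT.
apply: (le_trans (Ek k k0)); rewrite -EFinD lee_fin.
have le1 : a + k + (P0 + k) * (s + k) <= S + k * M.
  by rewrite /S /M; nra.
have ge1 : 0 <= a + k + (P0 + k) * (s + k).
  by rewrite !(addr_ge0, mulr_ge0) ?(ltW k0).
have sq1 : (a + k + (P0 + k) * (s + k)) ^+ 2 <= (S + k * M) ^+ 2.
  by rewrite lerXn2r ?nnegrE// addr_ge0 ?mulr_ge0 ?(ltW k0) ?(ltW M0).
apply: (le_trans sq1); have : k ^+ 2 * M ^+ 2 <= k * M ^+ 2.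
  by rewrite ler_wpM2r ?sqr_ge0// expr2 ler_piMr// ltW.
by move: ke; clear; nra.
Qed.

(** * The worst-case risk of a fixed coefficient vector *)

Section WorstCase.
Context {R : realType} {n N : nat}.
Variable p : 'cV[R]_n -> R.
Hypothesis sp : is_seminorm p.
Variable z : 'I_N -> data_space R n.
Variable b : 'cV[R]_n.

Definition empirical_risk : R := N%:R^-1 * \sum_(i < N) sq_loss b (z i).

Lemma empirical_risk_ge0 : 0 <= empirical_risk.
Proof.
by apply: mulr_ge0 => //; apply: sumr_ge0 => i _; exact: sqr_ge0.
Qed.

Lemma measurable_sq_lossE : measurable_fun [set: data_space R n]
  (EFin \o sq_loss b).
Proof. by apply/measurable_EFinP; exact: measurable_sq_loss. Qed.

Lemma sq_lossE_ge0 w : (0 <= (sq_loss b w)%:E)%E.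
Proof. by rewrite lee_fin sqr_ge0. Qed.

Lemma integral_empirical_risk :
  (\int[empirical z]_w (sq_loss b w)%:E = empirical_risk%:E)%E.
Proof.
rewrite (integral_empirical z sq_lossE_ge0 measurable_sq_lossE).
by rewrite sumEFin -EFinM.
Qed.

(** The residual under [mu] is the one under the empirical measure plus a
    change along the coupling, and the square of the change divided by [K] is
    below the cost. *)
Lemma coupling_risk_le (mu : {measure set (data_space R n) -> \bar R})
    (pi : probability (data_space R n * data_space R n)%type R)
    (t K kappa : R) :
  couplings mu (empirical z) pi -> 0 < t -> p b < K ->
  (\int[pi]_w label_cost p w.1 w.2 <= kappa%:E)%E ->
  (\int[mu]_w (sq_loss b w)%:E <=
    ((1 + t) * empirical_risk + (1 + t^-1) * (K ^+ 2 * kappa))%:E)%E.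
Proof.
move=> cpl t0 pK cost.
have K0 : 0 < K by apply: le_lt_trans pK; exact: (seminorm_ge0 sp).
have m1 : measurable_fun [set: data_space R n * data_space R n] fst by [].
have m2 : measurable_fun [set: data_space R n * data_space R n] snd by [].
rewrite (integral_marginal m1 (fun A mA => (cpl A mA).1) sq_lossE_ge0
  measurable_sq_lossE).
pose g (w : data_space R n * data_space R n) :=
  ((residual b w.1 - residual b w.2) / K) ^+ 2.
have g0 w : (0 <= (g w)%:E)%E by rewrite lee_fin sqr_ge0.
have mg : measurable_fun setT g.
  apply: measurable_funX; apply: measurable_funM => //; apply: measurable_funB.
  - exact: (measurableT_comp (measurable_residual b) m1).
  - exact: (measurableT_comp (measurable_residual b) m2).
have mgE : measurable_fun setT (EFin \o g) by exact/measurable_EFinP.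
have g_cost : (\int[pi]_w (g w)%:E <= kappa%:E)%E.
  apply: le_trans cost; apply: ge0_integral_mono => // w.
  exact: residual_shift_le_cost.
have t10 : 0 <= 1 + t by rewrite addr_ge0// ltW.
have t20 : 0 <= (1 + t^-1) * K ^+ 2.
  by rewrite mulr_ge0 ?sqr_ge0 ?addr_ge0 ?invr_ge0 ?ltW.
have mS : measurable_fun [set: data_space R n * data_space R n]
    (fun w => (sq_loss b w.2)%:E).
  exact: (measurableT_comp measurable_sq_lossE m2).
apply: (@le_trans _ _ (\int[pi]_w ((1 + t)%:E * (sq_loss b w.2)%:E +
    ((1 + t^-1) * K ^+ 2)%:E * (g w)%:E))%E).
  apply: ge0_integral_mono => [w|w]; first exact: sq_lossE_ge0.
  rewrite -!EFinM -EFinD lee_fin /g.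
  have := sqr_addr_le (residual b w.2) (residual b w.1 - residual b w.2) t0.
  rewrite addrC subrK => /le_trans; apply.
  rewrite lerD2l expr_div_n -[leRHS]mulrA [K ^+ 2 * _]mulrCA divff ?mulr1//.
  by rewrite expf_neq0// gt_eqF.
rewrite ge0_integralD//; first last.
- exact: measurable_funeM.
- by move=> w _; rewrite mule_ge0// lee_fin.
- exact: measurable_funeM.
- by move=> w _; rewrite mule_ge0 ?lee_fin// sqr_ge0.
rewrite !ge0_integralZl_EFin//; last by move=> w _; exact: sq_lossE_ge0.
rewrite -(integral_marginal m2 (fun A mA => (cpl A mA).2) sq_lossE_ge0
  measurable_sq_lossE) integral_empirical_risk [leRHS]EFinD.
apply: leeD; first by rewrite EFinM.
rewrite [X in (_ <= X%:E)%E]mulrA [leRHS]EFinM.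
by apply: lee_wpmul2l; rewrite ?lee_fin.
Qed.

Hypothesis N0 : (0 < N)%N.

(** Moving the i-th data point by [theta i] times a vector norming [b]: the
    obvious matching of atoms is a coupling, of cost at most the mean of
    [theta i ^+ 2]. *)
Lemma shifted_empirical (delta : R) (theta : 'I_N -> R) :
  N%:R^-1 * \sum_(i < N) theta i ^+ 2 <= delta ->
  exists mu : probability (data_space R n) R,
    (transport_cost (label_cost p) mu (empirical z) <= delta%:E)%E /\
    ('E_mu[sq_loss b] =
      (N%:R^-1 * \sum_(i < N) (residual b (z i) - theta i * p b) ^+ 2)%:E)%E.
Proof.
move=> thd; have [al [al_le alb]] := seminorm_norming sp b.
pose z' i : data_space R n := ((z i).1 + theta i *: al, (z i).2).
have [mu muE] := empirical_probability (R := R) z' N0.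
have [pi piE] := empirical_probability (R := R) (fun i => (z' i, z i)) N0.
exists mu; split.
- apply: (@le_trans _ _ (\int[pi]_w label_cost p w.1 w.2)%E).
    apply: ereal_inf_lbound; exists pi => // A mA; split.
      by apply: etrans (esym (muE A)); exact: piE.
    exact: piE.
  rewrite (eq_measure_integral (empirical (fun i => (z' i, z i)))); last first.
    by move=> A _ _; exact: piE.
  apply: (le_trans (integral_empirical_le _ _)).
    move=> w; rewrite /label_cost; case: ifP => _; last exact: leey.
    by rewrite expe2 mule_ge0//; exact: dual_norm_ge0.
  have cost_le i : (label_cost p (z' i) (z i) <= (theta i ^+ 2)%:E)%E.
    rewrite /label_cost /= eqxx addrAC subrr add0r -real_normK ?num_real//.
    rewrite expr2 EFinM.
    by apply: lee_pmul; rewrite ?dual_norm_ge0// dual_normZ_le.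
  apply: (@le_trans _ _ ((N%:R^-1)%:E * \sum_(i < N) (theta i ^+ 2)%:E)%E).
    apply: lee_wpmul2l; first by rewrite lee_fin.
    by apply: lee_sum => i _; exact: cost_le.
  by rewrite sumEFin -EFinM lee_fin.
- rewrite unlock (eq_measure_integral (empirical z')); last first.
    by move=> A _ _; exact: muE.
  rewrite (integral_empirical z' sq_lossE_ge0 measurable_sq_lossE).
  rewrite sumEFin -EFinM; congr (_ * _)%:E; apply: eq_bigr => i _.
  by rewrite /sq_loss /residual /= dotDr dotZr [dot b al]dotC alb opprD addrA.
Qed.

(** The second moment of the shift is [delta], and the shift is proportional to
    the residuals: the case of equality in the triangle inequality in L2. *)
Lemma worst_case_attained (delta : R) : 0 <= delta ->
  exists mu : probability (data_space R n) R,
    (transport_cost (label_cost p) mu (empirical z) <= delta%:E)%E /\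
    ('E_mu[sq_loss b] =
      ((Num.sqrt empirical_risk + Num.sqrt delta * p b) ^+ 2)%:E)%E.
Proof.
move=> d0; have r0 := empirical_risk_ge0.
have NN : N%:R != 0 :> R by rewrite pnatr_eq0 -lt0n.
have [rz|rnz] := eqVneq empirical_risk 0.
  have res0 i : residual b (z i) = 0.
    move/eqP: rz; rewrite mulf_eq0 invr_eq0 (negbTE NN)/=.
    rewrite psumr_eq0 => [|j _]; last exact: sqr_ge0.
    by move=> /allP/(_ i (mem_index_enum _)); rewrite /= sqrf_eq0 => /eqP.
  have [|mu [cost risk]] := @shifted_empirical delta (fun=> Num.sqrt delta).
    rewrite sumr_const card_ord sqr_sqrtr// -[X in _ * X]mulr_natl mulrA.
    by rewrite mulVf// mul1r.
  exists mu; split=> //; rewrite risk; congr EFin.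
  rewrite rz sqrtr0 add0r.
  under eq_bigr do rewrite res0 sub0r sqrrN.
  by rewrite sumr_const card_ord -[X in _ * X]mulr_natl mulrA mulVf// mul1r.
set a := Num.sqrt empirical_risk.
have aE : a ^+ 2 = empirical_risk by exact: sqr_sqrtr.
have a0 : a != 0 by rewrite -sqrf_eq0 aE.
(* The shifts are opposite to the residuals, which therefore all scale by
   [1 + c * p b]. *)
pose c := Num.sqrt delta / a.
pose theta i := - c * residual b (z i).
have [|mu [cost risk]] := @shifted_empirical delta theta.
  under eq_bigr do rewrite exprMn.
  rewrite -mulr_sumr mulrCA -[N%:R^-1 * _]/empirical_risk -aE sqrrN -exprMn.
  by rewrite divfK// sqr_sqrtr.
exists mu; split=> //; rewrite risk; congr EFin.
have residE i :
    residual b (z i) - theta i * p b = (1 + c * p b) * residual b (z i).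
  by rewrite /theta; ring.
under eq_bigr do rewrite residE exprMn.
rewrite -mulr_sumr mulrCA -[N%:R^-1 * _]/empirical_risk -aE -exprMn.
by congr (_ ^+ 2); rewrite /c; field.
Qed.

Lemma worst_case_risk (delta : R) : 0 <= delta ->
  ereal_sup [set 'E_mu[sq_loss b]%E | mu in
    [set mu : probability (data_space R n) R |
      (transport_cost (label_cost p) mu (empirical z) <= delta%:E)%E]]
  = ((Num.sqrt empirical_risk + Num.sqrt delta * p b) ^+ 2)%:E.
Proof.
move=> d0; apply/eqP; rewrite eq_le; apply/andP; split; last first.
  have [mu [cost <-]] := worst_case_attained d0.
  by apply: ereal_sup_ubound; exists mu.
apply: ge_ereal_sup => _ [mu /= cost <-]; rewrite unlock.
apply: le_sqr_sum_of_young => //.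
  exact: (seminorm_ge0 sp).
move=> t K kappa t0 pK dk; rewrite sqr_sqrtr ?empirical_risk_ge0//.
have /ereal_inf_lt[_ [pi cpl <-] /ltW] : (transport_cost (label_cost p) mu
  (empirical z) < kappa%:E)%E by apply: le_lt_trans cost _; rewrite lte_fin.
exact: coupling_risk_le.
Qed.

End WorstCase.

(** * From the mean squared residual to the regression objective *)

Lemma enorm_residuals {R : realType} {n N : nat} (x : 'I_N -> 'cV[R]_n)
    (y : 'I_N -> R) (b : 'cV[R]_n) :
  enorm (\col_(i < N) y i - (\matrix_(i < N, j < n) x i j 0) *m b) ^+ 2 =
  \sum_(i < N) sq_loss b (x i, y i).
Proof.
rewrite /enorm dotE sqr_sqrtr; last first.
  by apply: sumr_ge0 => i _; rewrite -expr2 sqr_ge0.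
apply: eq_bigr => i _; rewrite -expr2 /sq_loss /= !mxE dotC dotE.
by congr ((_ - _) ^+ 2); apply: eq_bigr => j _; rewrite mxE.
Qed.

Lemma worst_case_objective {R : realType} {n N : nat} (x : 'I_N -> 'cV[R]_n)
    (y : 'I_N -> R) (b : 'cV[R]_n) (delta r : R) :
  (0 < N)%N -> 0 <= delta ->
  (Num.sqrt (empirical_risk (fun i => (x i, y i)) b)
    + Num.sqrt delta * r) ^+ 2 =
  N%:R^-1 * (enorm (\col_(i < N) y i - (\matrix_(i < N, j < n) x i j 0) *m b)
    + Num.sqrt (delta * N%:R) * r) ^+ 2.
Proof.
move=> N0 delta0; rewrite /empirical_risk -enorm_residuals.
rewrite sqrtrM ?invr_ge0// sqrtr_sqr ger0_norm ?sqrtr_ge0// sqrtrM//.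
set q := Num.sqrt N%:R; have qE : q ^+ 2 = N%:R by exact: sqr_sqrtr.
have q0 : q != 0 by rewrite -sqrf_eq0 qE pnatr_eq0 -lt0n.
by rewrite sqrtrV// -/q -qE; field.
Qed.

Unset Implicit Arguments.
Set Strict Implicit.

Theorem theorem4 (R : realType) (n N s : nat)
  (n_gt0 : (0 < n)%N) (N_gt0 : (0 < N)%N) (s_gt0 : (0 < s)%N)
  (x : 'I_N -> 'cV[R]_n) (y : 'I_N -> R)
  (P : 'cV[R]_n -> R) (Q : 'cV[R]_s -> R)
  (P_norm : is_norm P) (Q_norm : is_norm Q)
  (B : 'M[R]_(s, n)) (w1 w2 : R)
  (w1_ge0 : 0 <= w1) (w2_ge0 : 0 <= w2) (w12 : w1 + w2 = 1)
  (delta : R) (delta_ge0 : 0 <= delta) :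
  let X : 'M[R]_(N, n) := \matrix_(i < N, j < n) x i j 0 in
  let Y : 'cV[R]_N := \col_(i < N) y i in
  let PN : {measure set (data_space R n) -> \bar R} :=
    empirical (fun i : 'I_N => (x i, y i) : data_space R n) in
  let p : 'cV[R]_n -> R := mixed_seminorm w1 w2 P Q B in
  ereal_inf [set
    ereal_sup [set 'E_mu[sq_loss b]%E | mu in
      [set mu : probability (data_space R n) R |
        (transport_cost (label_cost p) mu PN <= delta%:E)%E]]
    | b in [set: 'cV[R]_n]] =
  ((N%:R^-1)%:E *
   ereal_inf [set
     ((enorm (Y - X *m b) + Num.sqrt (delta * N%:R) * p b) ^+ 2)%:E
     | b in [set: 'cV[R]_n]])%E.
Proof.
move=> X Y PN p.
have sp : is_seminorm p by exact: mixed_seminorm_is_seminorm.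
rewrite -ereal_inf_pZl ?invr_gt0 ?ltr0n// image_comp; congr ereal_inf.
apply: eq_imagel => b _; rewrite /= -EFinM.
by rewrite (worst_case_risk sp) // worst_case_objective.
Qed.
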